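(* Let $X$ be a complex Hilbert space and let $$H=\begin{pmatrix} A & B\\ C & -A^*\end{pmatrix}$$ be a Hamiltonian operator matrix on $X\times X$. Suppose that $\mathcal{D}(H)=\mathcal{D}(A)\times\mathcal{D}(A^* )$ and that $A$ is self-adjoint. Then $JH=(JH)^*$ if one of the following holds: (1) $C$ is $A$-bounded with relative bound $<1$ and $B$ is $A^*$-bounded with relative bound $\leq 1$; (2) $C$ is $A$-bounded with relative bound $\leq 1$ and $B$ is $A^*$-bounded with relative bound $<1$.
   Context: All operators are linear and possibly unbounded; $\mathcal{D}(T)$ denotes the domain of $T$. Block operator matrix: for operators $A,B,C,D$ in $X$, the matrix $H=\begin{pmatrix} A&B\\ C&D\end{pmatrix}$ denotes the operator on $X\times X$ with domain $\mathcal{D}(H)=(\mathcal{D}(A)\cap\mathcal{D}(C))\times(\mathcal{D}(B)\cap\mathcal{D}(D))$ and action $H(x_1,x_2)^t=(Ax_1+Bx_2,\;Cx_1+Dx_2)^t$. Hamiltonian operator matrix: a block operator matrix $H=\begin{pmatrix} A&B\\ C&-A^*\end{pmatrix}$ on $X\times X$, $X$ a complex Hilbert space, where $A,B,C$ are closed densely defined operators in $X$, $B$ and $C$ are self-adjoint, and $H$ is densely defined. $J=\begin{pmatrix}0&I\\-I&0\end{pmatrix}$ on $X\times X$. Relative boundedness: $S$ is $T$-bounded if $\mathcal{D}(T)\subset\mathcal{D}(S)$ and there are $a,b\ge 0$ with $\|Sx\|\le a\|Tx\|+b\|x\|$ for all $x\in\mathcal{D}(T)$; the relative bound is the infimum of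 all such $a$. *)

(* Defs.v *)
From HB Require Import structures.
From mathcomp Require Import all_boot all_order all_algebra sesquilinear.
From mathcomp Require Import complex.
From mathcomp Require Import all_classical all_reals all_analysis.

Set Implicit Arguments.
Unset Strict Implicit.
Unset Printing Implicit Defensive.

Import Order.TTheory GRing.Theory Num.Theory.
Import numFieldNormedType.Exports.

Local Open Scope classical_set_scope.
Local Open Scope ring_scope.
Local Open Scope complex_scope.

(* A possibly unbounded operator is a domain together with a function whose
   values outside the domain are irrelevant: equality of operators is [op_eq].
   Linearity is the separate predicate [linear_op], so that [adjoint] below is
   total. *)
Record operator (V : Type) := Operator { dom : set V ; app :> V -> V }.

Definition op_eq (V : Type) (S T : operator V) : Prop :=
  dom S = dom T /\ forall x, dom T x -> S x = T x.

Definition graph (V : Type) (T : operator V) : set (V * V) :=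
  [set p | dom T p.1 /\ p.2 = T p.1].

Definition linear_op (R : realType) (V : lmodType R[i]) (T : operator V) : Prop :=
  [/\ dom T 0,
      forall (a : R[i]) x y, dom T x -> dom T y -> dom T (a *: x + y)
    & forall (a : R[i]) x y, dom T x -> dom T y ->
        T (a *: x + y) = a *: T x + T y].

Definition densely_defined (V : topologicalType) (T : operator V) : Prop :=
  dense (dom T).

Definition closed_op (V : topologicalType) (T : operator V) : Prop :=
  closed (graph T).

(* Meaningful for densely defined [T], in which case the [z] is unique. *)
Definition adjoint (R : realType) (V : lmodType R[i])
    (dot : {dot V for (@Num.conj R[i])}) (T : operator V) : operator V :=
  let adj y := [set z | forall x, dom T x -> dot (T x) y = dot x z] in
  Operator [set y | adj y !=set0] (fun y => xget 0 (adj y)).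

Definition self_adjoint (R : realType) (V : normedModType R[i])
    (dot : {dot V for (@Num.conj R[i])}) (T : operator V) : Prop :=
  densely_defined T /\ op_eq T (adjoint dot T).

Definition zero_op (V : zmodType) : operator V := Operator setT (fun=> 0).
Definition id_op (V : Type) : operator V := Operator setT id.
Definition opp_op (V : zmodType) (T : operator V) : operator V :=
  Operator (dom T) (fun x => - T x).
Definition comp_op (V : Type) (S T : operator V) : operator V :=
  Operator [set x | dom T x /\ dom S (T x)] (fun x => S (T x)).

Definition block_op (V : zmodType) (A B C D : operator V) : operator (V * V) :=
  Operator ((dom A `&` dom C) `*` (dom B `&` dom D))
           (fun p => (A p.1 + B p.2, C p.1 + D p.2)).

(* The Hilbert space inner product on X * X. The library's norm on a product is
   the max norm; it is equivalent to the norm of this inner product, and only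
   its topology is used. *)
Definition prod_dot (R : realType) (V : lmodType R[i])
    (dot : {dot V for (@Num.conj R[i])}) (p q : V * V) : R[i] :=
  dot p.1 q.1 + dot p.2 q.2.

Section prod_dot_instance.
Variables (R : realType) (V : lmodType R[i]).
Variable dot : {dot V for (@Num.conj R[i])}.

Let prod_dot_bilinear :
  bilinear_for *%R (@Num.conj R[i] \; *%R) (prod_dot dot).
Proof.
split=> [q|p] a x y; rewrite /prod_dot /=.
  by rewrite !linearPl /= mulrDr addrACA.
by rewrite !linearPr /= mulrDr addrACA.
Qed.

HB.instance Definition _ :=
  bilinear_isBilinear.Build R[i] (V * V)%type (V * V)%type R[i]
    *%R (@Num.conj R[i] \; *%R) (prod_dot dot) prod_dot_bilinear.

Let prod_dot_hermitian p q :
  prod_dot dot p q = (-1) ^+ false * Num.conj (prod_dot dot q p).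
Proof.
by rewrite /prod_dot rmorphD mulrDr -!(hermitian_subproof (s := dot)).
Qed.

HB.instance Definition _ :=
  isHermitianSesquilinear.Build R[i] (V * V)%type false (@Num.conj R[i])
    (prod_dot dot) prod_dot_hermitian.

Let prod_dot_gt0 p : p != 0 -> 0 < prod_dot dot p p.
Proof.
have dge0 (x : V) : 0 <= dot x x.
  have [->|x0] := eqVneq x 0; first by rewrite linear0l.
  exact/ltW/neq0_dnorm_gt0.
case: p => x y; rewrite -pair_eqE negb_and /= => /orP[x0|y0].
  by rewrite ltr_wpDr ?dge0 ?neq0_dnorm_gt0.
by rewrite ltr_wpDl ?dge0 ?neq0_dnorm_gt0.
Qed.

HB.instance Definition _ :=
  isDotProduct.Build R[i] (V * V)%type (prod_dot dot) prod_dot_gt0.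

End prod_dot_instance.

Definition J_op (V : zmodType) : operator (V * V) :=
  block_op (zero_op V) (id_op V) (opp_op (id_op V)) (zero_op V).

Definition hamiltonian_op (R : realType) (V : lmodType R[i])
    (dot : {dot V for (@Num.conj R[i])}) (A B C : operator V) :
    operator (V * V) :=
  block_op A B C (opp_op (adjoint dot A)).

Definition is_hamiltonian (R : realType) (V : normedModType R[i])
    (dot : {dot V for (@Num.conj R[i])}) (A B C : operator V) : Prop :=
  [/\ [/\ linear_op A, linear_op B & linear_op C],
      [/\ closed_op A, closed_op B & closed_op C],
      [/\ densely_defined A, densely_defined B & densely_defined C],
      self_adjoint dot B /\ self_adjoint dot C
    & densely_defined (hamiltonian_op dot A B C)].

Definition rel_bounds (R : realType) (V : normedModType R[i])
    (S T : operator V) : set R :=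
  [set a | 0 <= a /\ exists2 b : R, 0 <= b &
     forall x, dom T x -> `|S x| <= a%:C * `|T x| + b%:C * `|x| ].

Definition rel_bounded (R : realType) (V : normedModType R[i])
    (S T : operator V) : Prop :=
  dom T `<=` dom S /\ rel_bounds S T !=set0.

Definition rel_bound (R : realType) (V : normedModType R[i])
    (S T : operator V) : R :=
  inf (rel_bounds S T).

(* Main.v *)
Require Import Defs.
From mathcomp Require Import all_boot all_order all_algebra sesquilinear.
From mathcomp Require Import complex ring lra.
From mathcomp Require Import all_classical all_reals all_analysis.

Set Implicit Arguments.
Unset Strict Implicit.
Unset Printing Implicit Defensive.

Import Order.TTheory GRing.Theory Num.Theory.
Import numFieldNormedType.Exports.

Local Open Scope classical_set_scope.
Local Open Scope ring_scope.
Local Open Scope complex_scope.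

(** Since [A] is self-adjoint, [J H] is, on the domain [D(A) x D(A)], the operator
    [K = (C, - A; - A, - B)], which is the self-adjoint [S = (0, - A; - A, 0)]
    perturbed by the symmetric diagonal operator [T = diag (C, - B)].  The
    Kato-Rellich theorem needs a relative bound strictly below one, but here
    one of the two diagonal entries is only known to have relative bound at
    most one.  The remedy is the congruence of [K] by [diag (l, 1)]: up to the
    factor [l] it leaves [S] unchanged and replaces [T] by
    [diag (l C, - l^-1 B)].  If [r1] and [r2] exceed the relative bounds of [C]
    and [B], the choice [l ^ 2 = r2 / r1] makes both entries relatively bounded
    with constant [sqrt (r1 r2)], and in both cases of the theorem [r1] and
    [r2] can be chosen with [r1 r2 < 1].  A congruence by an invertible bounded
    operator preserves self-adjointness, so [K] is self-adjoint
    ([selfadjoint_jhamiltonian_op]).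

    The Kato-Rellich theorem itself ([kato_rellich]) comes from the
    criterion that a symmetric operator [K] is self-adjoint as soon as
    [K + i mu] and [K - i mu] are onto ([selfadjoint_re_of_onto]).
    Surjectivity is obtained from [closed_range_onto]: a linear operator with
    closed range and no nonzero vector orthogonal to its range is onto, because
    the distance from a point to the range is attained.  This is applied first to
    [S + i mu], and then to [S + T + i mu]: if [y] is orthogonal to the range
    of the latter and [(S + i mu) x = y], then [y] is orthogonal to [y + T x], so
    [|y| <= |T x|] by Pythagoras, whereas [|T x| < |y|] for [y <> 0] and [mu] large.

    All estimates concern the real part of the inner product and the
    squared norm, which avoids square roots and stays within the ordered field
    of real numbers.  Since the operators are complex linear, nothing is lost. *)

(** * The real part of an inner product *)

Section ComplexRe.
Context {R : realType}.
Implicit Types (z w : R[i]) (r : R).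

Lemma ReD z w : complex.Re (z + w) = complex.Re z + complex.Re w.
Proof. by case: z; case: w. Qed.

Lemma ReN z : complex.Re (- z) = - complex.Re z.
Proof. by case: z. Qed.

Lemma ReZ r z : complex.Re (r%:C * z) = r * complex.Re z.
Proof. by case: z => a b /=; rewrite mul0r subr0. Qed.

Lemma ReIM z : complex.Re ('i * z) = - complex.Im z.
Proof. by case: z => a b /=; rewrite mul0r mul1r sub0r. Qed.

End ComplexRe.

Section RealForm.
Context {R : realType} {V : lmodType R[i]} (dot : {dot V for (@Num.conj R[i])}).
Implicit Types (x y z : V) (r : R).

Definition re_dot x y : R := complex.Re (dot x y).
Local Notation re := re_dot.

Definition sqnorm x : R := re x x.
Local Notation sqn := sqnorm.

Lemma dotC x y : dot x y = (dot y x)^*%C.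
Proof. by rewrite hermC expr0 mul1r. Qed.

Lemma reC x y : re x y = re y x.
Proof. by rewrite /re_dot dotC; case: (dot y x). Qed.

Lemma reDl x y z : re (x + y) z = re x z + re y z.
Proof. by rewrite /re_dot linearDl; apply: ReD. Qed.

Lemma reNl x z : re (- x) z = - re x z.
Proof. by rewrite /re_dot linearNl; apply: ReN. Qed.

Lemma reZl r x z : re (r%:C *: x) z = r * re x z.
Proof. by rewrite /re_dot linearZl_LR; apply: ReZ. Qed.

Lemma reDr x y z : re z (x + y) = re z x + re z y.
Proof. by rewrite reC reDl !(reC z). Qed.

Lemma reNr x z : re z (- x) = - re z x.
Proof. by rewrite reC reNl (reC z). Qed.

Lemma reZr r x z : re z (r%:C *: x) = r * re z x.
Proof. by rewrite reC reZl (reC z). Qed.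

Lemma reIl x y : re ('i *: x) y = - complex.Im (dot x y).
Proof. by rewrite /re_dot linearZl_LR; apply: ReIM. Qed.

Lemma reIr x y : re x ('i *: y) = complex.Im (dot x y).
Proof. by rewrite reC reIl dotC; case: (dot x y) => a b /=; rewrite opprK. Qed.

Lemma reIC x y : re ('i *: x) y = - re x ('i *: y).
Proof. by rewrite reIl reIr. Qed.

Lemma reI x y : re ('i *: x) ('i *: y) = re x y.
Proof.
by rewrite reIC scalerA -expr2 sqr_i scaleN1r reNr opprK.
Qed.

Definition reE := (reDl, reDr, reNl, reNr, reZl, reZr, reI).

Lemma sqn_ge0 x : 0 <= sqn x.
Proof. by have := dnorm_ge0 dot x; rewrite lecE /= => /andP[]. Qed.

Lemma sqn_eq0 x : sqn x = 0 -> x = 0.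
Proof.
move=> x0; apply/eqP; rewrite -(dnorm_eq0 dot) eq_complex/=.
have := dnorm_ge0 dot x; rewrite lecE /= => /andP[/eqP-> _].
by rewrite eqxx andbT; apply/eqP.
Qed.

Lemma re0l x : re 0 x = 0.
Proof. by rewrite /re_dot linear0l. Qed.

Lemma sqnN x : sqn (- x) = sqn x.
Proof. by rewrite /sqnorm !reE opprK. Qed.

Lemma sqnZ r x : sqn (r%:C *: x) = r ^+ 2 * sqn x.
Proof. by rewrite /sqnorm !reE mulrA. Qed.

Lemma sqnI x : sqn ('i *: x) = sqn x.
Proof. exact: reI. Qed.

Lemma sqnD x y : sqn (x + y) = sqn x + 2 * re x y + sqn y.
Proof. by rewrite /sqnorm !reE (reC y x); lra. Qed.

Lemma cauchy_schwarz x y : re x y ^+ 2 <= sqn x * sqn y.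
Proof.
have [/sqn_eq0->|y0] := eqVneq (sqn y) 0.
  by rewrite reC /sqnorm !re0l expr0n mulr0.
have ypos : 0 < sqn y by rewrite lt_neqAle eq_sym y0 sqn_ge0.
(* This vector is the component of [x] orthogonal to [y], times [sqn y]. *)
have := sqn_ge0 ((sqn y)%:C *: x - (re x y)%:C *: y).
rewrite sqnD sqnN !sqnZ !reE.
rewrite (_ : _ + _ = sqn y * (sqn x * sqn y - re x y ^+ 2)); last by ring.
by rewrite pmulr_rge0// subr_ge0.
Qed.

(** The free parameter makes it possible to absorb the first term when
    [sqn x] carries a constant only slightly less than one. *)
Lemma young x y (e : R) : 0 < e ->
  sqn (x + y) <= (1 + e) * sqn x + (1 + e^-1) * sqn y.
Proof.
move=> e0; have := sqn_ge0 (e%:C *: x - y).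
rewrite [sqn (_ - _)]sqnD sqnN sqnZ !reE => h.
have e1 : e * e^-1 = 1 by rewrite mulfV// gt_eqF.
have : 0 <= e^-1 * (e ^+ 2 * sqn x + 2 * - (e * re x y) + sqn y).
  by rewrite mulr_ge0// invr_ge0 ltW.
have -> : e^-1 * (e ^+ 2 * sqn x + 2 * - (e * re x y) + sqn y) =
   (e * e^-1) * e * sqn x - (e * e^-1) * 2 * re x y + e^-1 * sqn y by ring.
by rewrite e1 sqnD; lra.
Qed.

(** The parallelogram identity, with the sum written as a midpoint because the
    midpoint is what is compared with the infimum when a distance is minimized. *)
Lemma sqn_half x y : sqn (x - y) =
  2 * sqn x + 2 * sqn y - 4 * sqn (2^-1%:C *: (x + y)).
Proof. by rewrite sqnZ !sqnD sqnN reNr; lra. Qed.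

(** Continuity of the inner product, in the only form needed: orthogonality to
    [u] passes to limits, even when it holds only approximately. *)
Lemma re_limit0 (l u : V) :
  (forall e, 0 < e -> exists v, sqn (v - l) < e /\ re v u ^+ 2 <= e) ->
  re l u = 0.
Proof.
move=> h; apply/eqP; apply: contraT => lu0.
have k0 : 0 < re l u ^+ 2 by rewrite exprn_even_gt0.
have u1 : 0 < 1 + sqn u by rewrite ltr_pwDl// sqn_ge0.
have [] := h (re l u ^+ 2 / (4 * (1 + sqn u))); first by rewrite divr_gt0// mulr_gt0.
set e := _ / _ => v [vl vu].
have ee : e * (1 + sqn u) = re l u ^+ 2 / 4 by rewrite /e; field; rewrite gt_eqF.
have := cauchy_schwarz (v - l) u; rewrite !reE => cs.
have cs' : (re v u - re l u) ^+ 2 <= e * sqn u.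
  by apply: le_trans cs _; rewrite ler_wpM2r ?sqn_ge0// ltW.
have := sqr_ge0 (2 * re v u - re l u); nra.
Qed.

(** Completeness is expressed through [sqnorm] alone, so that it applies both to
    [X] and to [X * X], whose norm is not the one of its inner product. *)
Definition cauchy_sqn (u : nat -> V) := forall e, 0 < e ->
  exists N, forall m n, (N <= m)%N -> (N <= n)%N -> sqn (u m - u n) < e.

Definition cvg_sqn (u : nat -> V) (l : V) := forall e, 0 < e ->
  exists N, forall n, (N <= n)%N -> sqn (u n - l) < e.

Definition complete_sqn := forall u, cauchy_sqn u -> exists l, cvg_sqn u l.

Lemma cauchy_sqn_le (M : R) (u v : nat -> V) :
  (forall m n, sqn (v m - v n) <= M * sqn (u m - u n)) ->
  cauchy_sqn u -> cauchy_sqn v.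
Proof.
move=> h cu e e0.
have M1 : 0 < 1 + `|M| by rewrite ltr_pwDl.
have [N hN] := cu (e / (1 + `|M|)) (divr_gt0 e0 M1).
exists N => m n Nm Nn; apply: le_lt_trans (h m n) _.
have := hN m n Nm Nn; rewrite ltr_pdivlMr//; apply: le_lt_trans.
rewrite mulrC ler_wpM2l ?sqn_ge0// (le_trans (ler_norm M))//; lra.
Qed.

Lemma cvg_sqn_le2 (M : R) (u v w : nat -> V) (k l p : V) :
  (forall n, sqn (w n - p) <= M * (sqn (u n - k) + sqn (v n - l))) ->
  cvg_sqn u k -> cvg_sqn v l -> cvg_sqn w p.
Proof.
move=> h cu cv e e0.
have M1 : 0 < 1 + `|M| by rewrite ltr_pwDl.
have e2 : 0 < e / (1 + `|M|) / 2 by rewrite !divr_gt0.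
have [N hN] := cu _ e2; have [P hP] := cv _ e2.
exists (maxn N P) => n; rewrite geq_max => /andP[/hN n1 /hP n2].
apply: le_lt_trans (h n) _.
have n3 : sqn (u n - k) + sqn (v n - l) < e / (1 + `|M|) by lra.
move: n3; rewrite ltr_pdivlMr//; apply: le_lt_trans.
rewrite mulrC ler_wpM2l ?addr_ge0 ?sqn_ge0// (le_trans (ler_norm M))//; lra.
Qed.

End RealForm.

(** * Linear operators and surjectivity *)

Section LinearOperator.
Context {R : realType} {V : lmodType R[i]} (L : operator V).
Hypothesis linL : linear_op L.
Implicit Types (x y : V) (a : R[i]).

Lemma linear_domP a x y : dom L x -> dom L y -> dom L (a *: x + y).
Proof. by case: linL => _ + _; apply. Qed.

Lemma linear_domD x y : dom L x -> dom L y -> dom L (x + y).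
Proof. by move=> dx dy; rewrite -[x]scale1r; apply: linear_domP. Qed.

Lemma linear_domZ a x : dom L x -> dom L (a *: x).
Proof.
by move=> dx; rewrite -[a *: x]addr0; apply: linear_domP => //; case: linL.
Qed.

Lemma linear_domB x y : dom L x -> dom L y -> dom L (x - y).
Proof.
by move=> dx dy; rewrite -scaleN1r; apply: linear_domD => //; apply: linear_domZ.
Qed.

Lemma linear_opP a x y : dom L x -> dom L y -> L (a *: x + y) = a *: L x + L y.
Proof. by case: linL => _ _; apply. Qed.

Lemma linear_opD x y : dom L x -> dom L y -> L (x + y) = L x + L y.
Proof. by move=> dx dy; rewrite -[x in LHS]scale1r linear_opP// scale1r. Qed.

Lemma linear_op0 : L 0 = 0.
Proof.
have d0 : dom L 0 by case: linL.
by apply: (addrI (L 0)); rewrite -linear_opD// !addr0.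
Qed.

Lemma linear_opZ a x : dom L x -> L (a *: x) = a *: L x.
Proof.
move=> dx; rewrite -[a *: x]addr0 linear_opP//; last by case: linL.
by rewrite linear_op0 addr0.
Qed.

Lemma linear_opB x y : dom L x -> dom L y -> L (x - y) = L x - L y.
Proof.
move=> dx dy; rewrite -scaleN1r linear_opD//; last exact: linear_domZ.
by rewrite linear_opZ// scaleN1r.
Qed.

End LinearOperator.

Section Operators.
Context {R : realType} {V : lmodType R[i]}.
Implicit Types (S T : operator V) (mu : R).

Definition shift_op S mu : operator V :=
  Operator (dom S) (fun x => S x + mu%:C *: ('i *: x)).

Definition add_op S T : operator V :=
  Operator (dom S) (fun x => S x + T x).

Lemma linear_shift_op S mu : linear_op S -> linear_op (shift_op S mu).
Proof.
move=> linS; split => [|a x y|a x y] /=; first by case: linS.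
  exact: linear_domP.
move=> dx dy; rewrite linear_opP// !scalerDr !scalerA addrACA.
by congr (_ + _ *: _ + _); ring.
Qed.

Lemma linear_add_op S T : linear_op S -> linear_op T -> dom S `<=` dom T ->
  linear_op (add_op S T).
Proof.
move=> linS linT ST; split => [|a x y|a x y] /=; first by case: linS.
  exact: linear_domP.
move=> dx dy; rewrite !linear_opP//; try exact: ST.
by rewrite scalerDr addrACA.
Qed.

End Operators.

Lemma invn_small {R : realType} (e : R) : 0 < e ->
  exists N, forall n, (N <= n)%N -> n.+1%:R^-1 < e.
Proof.
move=> e0; have [N _ hN] := near_infty_natSinv_lt (PosNum e0).
by exists N => n /hN.
Qed.

Section ClosedRange.
Context {R : realType} {V : lmodType R[i]} (dot : {dot V for (@Num.conj R[i])}).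
Local Notation re := (re_dot dot).
Local Notation sqn := (sqnorm dot).

(** A minimizing sequence for the distance from [y] to the range is Cauchy by the
    parallelogram identity, hence converges to a point of the range, as the
    range is closed; the difference between [y] and that point is orthogonal to
    the range, since otherwise moving along the range would bring it closer. *)
Lemma closed_range_onto (L : operator V) : linear_op L ->
  (forall x : nat -> V, (forall n, dom L (x n)) ->
    cauchy_sqn dot (fun n => L (x n)) ->
    exists2 x0, dom L x0 & cvg_sqn dot (fun n => L (x n)) (L x0)) ->
  (forall y, (forall x, dom L x -> re (L x) y = 0) -> y = 0) ->
  forall y, exists2 x, dom L x & L x = y.
Proof.
move=> linL clL orthL y.
pose Q := [set sqn (y - L x) | x in dom L].
have Q0 : lbound Q 0 by move=> _ [x _ <-]; apply: sqn_ge0.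
have infQ : has_inf Q.
  by split; [exists (sqn (y - L 0)), 0 => //; case: linL | exists 0].
have dQ x : dom L x -> inf Q <= sqn (y - L x).
  by move=> dx; apply: ge_inf; [exists 0 | exists x].
have exQ n : exists x, dom L x /\ sqn (y - L x) < inf Q + n.+1%:R^-1.
  have n0 : 0 < n.+1%:R^-1 :> R by rewrite invr_gt0.
  by have [_ [x dx <-] lx] := inf_adherent n0 infQ; exists x.
have [x {exQ} hx] := choice exQ.
have dx n : dom L (x n) by case: (hx n).
have lx n : sqn (y - L (x n)) < inf Q + n.+1%:R^-1 by case: (hx n).
have cx : cauchy_sqn dot (fun n => L (x n)).
  move=> e e0; have e4 : 0 < e / 4 by rewrite divr_gt0.
  have [N hN] := invn_small e4; exists N => m n Nm Nn.
  have -> : L (x m) - L (x n) = (y - L (x n)) - (y - L (x m)).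
    by rewrite opprB [RHS]addrC subrKA.
  rewrite sqn_half.
  have -> : (2^-1)%:C *: (y - L (x n) + (y - L (x m))) =
            y - L ((2^-1)%:C *: (x n + x m)).
    rewrite linear_opZ ?linear_opD//; last exact: linear_domD.
    rewrite addrACA -opprD scalerBr; congr (_ - _).
    rewrite scalerDr -scalerDl -rmorphD /=.
    by rewrite [_ + _ in LHS](_ : _ = 1) ?scale1r//; field.
  have := dQ ((2^-1)%:C *: (x n + x m)) (linear_domZ linL _ (linear_domD linL (dx n) (dx m))).
  have := lx m; have := lx n; have := hN m Nm; have := hN n Nn.
  by move: (n.+1%:R^-1) (m.+1%:R^-1) => a b *; lra.
have [x0 dx0 cx0] := clL x dx cx.
exists x0 => //; apply/eqP; rewrite eq_sym -subr_eq0; apply/eqP.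
apply: orthL => u du; rewrite reC; apply: (re_limit0 (dot := dot)) => e e0.
have e1 : 0 < e / (1 + sqn (L u)) by rewrite divr_gt0// ltr_pwDl// sqn_ge0.
have [N hN] := cx0 e e0; have [P hP] := invn_small e1.
pose n := maxn N P.
have {}hN := hN n (leq_maxl _ _); have {}hP := hP n (leq_maxr _ _).
exists (y - L (x n)); split.
  rewrite [X in sqn X](_ : _ = - (L (x n) - L x0)) ?sqnN//.
  by rewrite !opprB [LHS]addrC subrKA.
have [/sqn_eq0->|s0] := eqVneq (sqn (L u)) 0.
  by rewrite reC re0l expr0n ltW.
have spos : 0 < sqn (L u) by rewrite lt_neqAle eq_sym s0 sqn_ge0.
(* The coefficient below minimizes the distance from [v] to the multiples of
   [L u], so that near-minimality of [v] bounds its component along [L u]. *)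
set v := y - _; set s := sqn (L u) in s0 spos hP *.
have := dQ ((re v (L u) / s)%:C *: u + x n) (linear_domP linL _ du (dx n)).
rewrite linear_opP// opprD addrCA addrC -/v sqnD sqnN sqnZ reNr reZr -/s.
have -> : (re v (L u) / s) ^+ 2 * s = re v (L u) ^+ 2 / s by field.
have -> : re v (L u) / s * re v (L u) = re v (L u) ^+ 2 / s by field.
have := lx n; rewrite -/v => h1 h2.
have : re v (L u) ^+ 2 / s < n.+1%:R^-1.
  by move: (n.+1%:R^-1) h1 h2 => b *; lra.
rewrite ltr_pdivrMr// => /ltW/le_trans; apply.
move: hP; rewrite ltr_pdivlMr ?ltr_pwDl// => [/ltW|]; last exact: ltW.
by apply: le_trans; rewrite ler_wpM2l ?invr_ge0//; lra.
Qed.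

End ClosedRange.

(** * The product space *)

Section ProductForm.
Context {R : realType} {V : lmodType R[i]} (dot : {dot V for (@Num.conj R[i])}).

Lemma re_prod (p q : V * V) :
  re_dot (prod_dot dot) p q = re_dot dot p.1 q.1 + re_dot dot p.2 q.2.
Proof. exact: ReD. Qed.

Lemma sqn_prod (p : V * V) :
  sqnorm (prod_dot dot) p = sqnorm dot p.1 + sqnorm dot p.2.
Proof. exact: re_prod. Qed.

Lemma complete_prod : complete_sqn dot -> complete_sqn (prod_dot dot).
Proof.
move=> cdot u cu.
have [] := cdot (fun n => (u n).1).
  move=> e /cu[N hN]; exists N => m n Nm Nn; apply: le_lt_trans (hN m n Nm Nn).
  by rewrite sqn_prod lerDl sqn_ge0.
move=> l1 h1.
have [] := cdot (fun n => (u n).2).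
  move=> e /cu[N hN]; exists N => m n Nm Nn; apply: le_lt_trans (hN m n Nm Nn).
  by rewrite sqn_prod lerDr sqn_ge0.
move=> l2 h2; exists (l1, l2) => e e0.
have e2 : 0 < e / 2 by rewrite divr_gt0.
have [N hN] := h1 _ e2; have [P hP] := h2 _ e2.
exists (maxn N P) => n; rewrite geq_max => /andP[/hN n1 /hP n2].
by rewrite sqn_prod /=; lra.
Qed.

End ProductForm.

(** * Self-adjointness and the Kato-Rellich theorem *)

Section KatoRellich.
Context {R : realType} {V : lmodType R[i]} (dot : {dot V for (@Num.conj R[i])}).
Hypothesis complete_dot : complete_sqn dot.
Local Notation re := (re_dot dot).
Local Notation sqn := (sqnorm dot).
Implicit Types (S T : operator V) (x y : V).

Definition total_set (D : set V) := forall y, (forall x, D x -> re x y = 0) -> y = 0.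

Definition symmetric_on (D : set V) T :=
  forall x y, D x -> D y -> re (T x) y = re x (T y).

(** Half of self-adjointness: the domain of the adjoint is contained in that of
    [T].  The vector [z] plays the role of the value of the adjoint at [y]. *)
Definition adjoint_in_dom T := forall y z,
  (forall x, dom T x -> re (T x) y = re x z) -> dom T y.

Definition selfadjoint_re T :=
  [/\ total_set (dom T), symmetric_on (dom T) T & adjoint_in_dom T].

Lemma selfadjoint_re_val T y z : selfadjoint_re T ->
  (forall x, dom T x -> re (T x) y = re x z) -> dom T y /\ T y = z.
Proof.
move=> [totT symT adjT] yz; have dy := adjT y z yz; split=> //.
apply/eqP; rewrite -subr_eq0; apply/eqP; apply: totT => x dx.
by rewrite !reE -symT// yz// subrr.
Qed.

(** A self-adjoint operator is closed, because the adjoint relation is a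
    family of orthogonality conditions on the graph. *)
Lemma selfadjoint_re_closed S (x : nat -> V) : selfadjoint_re S ->
  (forall n, dom S (x n)) -> cauchy_sqn dot x -> cauchy_sqn dot (fun n => S (x n)) ->
  exists x0, [/\ dom S x0, cvg_sqn dot x x0 & cvg_sqn dot (fun n => S (x n)) (S x0)].
Proof.
move=> saS dx cx cSx; have [x0 hx0] := complete_dot cx.
have [w hw] := complete_dot cSx.
suff [d0 S0] : dom S x0 /\ S x0 = w by exists x0; split=> //; rewrite S0.
apply: selfadjoint_re_val => // u du.
(* The graph of [S] consists of the pairs orthogonal to every [(S u, - u)]. *)
have : re_dot (prod_dot dot) (x0, w) (S u, - u) = 0.
  apply: re_limit0 => e e0.
  have e2 : 0 < e / 2 by rewrite divr_gt0.
  have [N hN] := hx0 _ e2; have [P hP] := hw _ e2.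
  pose n := maxn N P; exists (x n, S (x n)); split.
    have := hN n (leq_maxl _ _); have := hP n (leq_maxr _ _).
    by rewrite sqn_prod /=; lra.
  case: saS => _ symS _.
  by rewrite re_prod /= reNr symS// subrr expr0n ltW.
rewrite re_prod /= reNr => /eqP; rewrite subr_eq0 => /eqP.
by rewrite reC => ->; rewrite reC.
Qed.

(** The quadratic form of a symmetric operator is real; this is what makes
    [S x] and [i mu x] orthogonal in [sqn_shift_op]. *)
Lemma symmetric_reI S x : linear_op S -> symmetric_on (dom S) S -> dom S x ->
  re (S x) ('i *: x) = 0.
Proof.
move=> linS symS dx; have dIx := linear_domZ linS 'i dx.
have : re (S x) ('i *: x) = - re (S x) ('i *: x).
  by rewrite {1}symS// (linear_opZ linS)// [in RHS]reC reIC opprK.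
by lra.
Qed.

Lemma sqn_shift_op S mu x : linear_op S -> symmetric_on (dom S) S -> dom S x ->
  sqn (shift_op S mu x) = sqn (S x) + mu ^+ 2 * sqn x.
Proof.
by move=> linS symS dx; rewrite sqnD reZr symmetric_reI// !mulr0 addr0 sqnZ sqnI.
Qed.

(** By [sqn_shift_op] the graph norm of [S] is controlled by [S + i mu], so the
    range is closed; a vector orthogonal to the range lies in the domain of [S]
    and is an eigenvector for the non-real eigenvalue [i mu], hence vanishes. *)
Lemma shift_op_onto S mu : linear_op S -> selfadjoint_re S -> mu != 0 ->
  forall y, exists2 x, dom S x & shift_op S mu x = y.
Proof.
move=> linS saS mu0; have [totS symS adjS] := saS.
have mu2 : 0 < mu ^+ 2 by rewrite exprn_even_gt0.
have linL := linear_shift_op mu linS.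
have shiftB x y : dom S x -> dom S y -> sqn (shift_op S mu x - shift_op S mu y) =
    sqn (S x - S y) + mu ^+ 2 * sqn (x - y).
  move=> dx dy; rewrite -(linear_opB linL)// sqn_shift_op ?(linear_opB linS)//.
  exact: linear_domB.
apply: (closed_range_onto (dot := dot) linL) => [x dL cx|y orthy].
  have dx n : dom S (x n) := dL n.
  have [] := selfadjoint_re_closed saS dx.
  - apply: (cauchy_sqn_le (M := mu ^- 2)) cx => m n.
    rewrite mulrC ler_pdivlMr// mulrC (shiftB _ _ (dx m) (dx n)).
    by rewrite lerDr sqn_ge0.
  - apply: (cauchy_sqn_le (M := 1)) cx => m n.
    rewrite mul1r (shiftB _ _ (dx m) (dx n)) lerDl.
    by rewrite mulr_ge0 ?sqn_ge0 ?ltW.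
  move=> x0 [dx0 hx0 hSx0]; exists x0 => //.
  apply: (cvg_sqn_le2 (M := 1 + mu ^+ 2)) hx0 hSx0 => n.
  rewrite (shiftB _ _ (dx n) dx0).
  have := sqn_ge0 dot (x n - x0); have := sqn_ge0 dot (S (x n) - S x0); nra.
have [dy Sy] : dom S y /\ S y = mu%:C *: ('i *: y).
  apply: selfadjoint_re_val => // x dx; have := orthy x dx.
  by rewrite /= !reE reIC => h; lra.
have := symmetric_reI linS symS dy.
rewrite Sy reZl -/(sqnorm _ _) sqnI => /eqP; rewrite mulf_eq0 (negPf mu0) => /eqP.
exact: sqn_eq0.
Qed.

(** The condition on [mu] gives [sqn (T x) <= a * sqn ((S + i mu) x)].  With
    [a < 1] this bounds [(S + i mu) x] by [(S + T + i mu) x], whence the closed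
    range, and it leaves no nonzero vector orthogonal to the range. *)
Lemma shift_add_onto S T mu (a b : R) : linear_op S -> linear_op T ->
  selfadjoint_re S -> dom S `<=` dom T ->
  0 < a < 1 -> mu != 0 -> b <= a * mu ^+ 2 ->
  (forall x, dom S x -> sqn (T x) <= a * sqn (S x) + b * sqn x) ->
  forall y, exists2 x, dom S x & shift_op (add_op S T) mu x = y.
Proof.
move=> linS linT saS ST /andP[a0 a1] mu0 bmu bndT; have [totS symS adjS] := saS.
have mu2 : 0 < mu ^+ 2 by rewrite exprn_even_gt0.
have linST := linear_add_op linS linT ST.
have linL := linear_shift_op mu linST.
set L := shift_op _ _.
have LE x : L x = shift_op S mu x + T x by rewrite /= addrAC.
have bnd x : dom S x -> sqn (T x) <= a * sqn (shift_op S mu x).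
  move=> dx; apply: le_trans (bndT x dx) _.
  rewrite sqn_shift_op// mulrDr mulrA lerD2l ler_wpM2r ?sqn_ge0//.
pose M := 6 / (1 - a) ^+ 2.
have M0 : 0 < M by rewrite divr_gt0// exprn_gt0// subr_gt0.
have low x : dom S x -> sqn (shift_op S mu x) <= M * sqn (L x).
  move=> dx; set s := shift_op S mu x.
  have a2 : 0 < (1 - a) / 2 by rewrite divr_gt0// subr_gt0.
  (* With this parameter the coefficient of [sqn s] on the right becomes
     [(1 + (1 - a) / 2) * a], which is still below one. *)
  have := young dot (- T x) (L x) a2; rewrite sqnN.
  have := bnd x dx; rewrite -/s.
  rewrite (_ : - T x + L x = s); last by rewrite LE addrCA addNr addr0.
  have -> : ((1 - a) / 2)^-1 = 2 / (1 - a) by rewrite invf_div.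
  move=> h1 h2; rewrite /M mulrAC ler_pdivlMr ?exprn_gt0 ?subr_gt0//.
  have sL : (1 - a) * ((1 + 2 / (1 - a)) * sqn (L x)) = (3 - a) * sqn (L x).
    by field; rewrite gt_eqF// subr_gt0.
  have s0 := sqn_ge0 dot s; have L0 := sqn_ge0 dot (L x).
  have b1 : 0 <= 1 - a by rewrite subr_ge0 ltW.
  have : (1 - a) * sqn s <=
      (1 - a) * ((1 + (1 - a) / 2) * (a * sqn s)) + (3 - a) * sqn (L x).
    rewrite -sL -mulrDr ler_wpM2l//; apply: le_trans h2 _.
    by rewrite lerD2r ler_wpM2l//; lra.
  have : (1 - a) * sqn s - (1 - a) * ((1 + (1 - a) / 2) * (a * sqn s)) =
      (1 - a) ^+ 2 * sqn s / 2 + (1 - a) ^+ 3 * sqn s / 2 by field.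
  have : 0 <= (1 - a) ^+ 3 * sqn s / 2 by rewrite !mulr_ge0// exprn_ge0.
  have : 0 <= a * sqn (L x) by rewrite mulr_ge0// ltW.
  lra.
apply: (closed_range_onto (dot := dot) linL) => [x dL cx|y orthy].
  have dx n : dom S (x n) := dL n.
  have lowB m n : sqn (S (x m) - S (x n)) + mu ^+ 2 * sqn (x m - x n) <=
      M * sqn (L (x m) - L (x n)).
    have dmn : dom S (x m - x n) by apply: (linear_domB linS).
    have := low _ dmn; rewrite sqn_shift_op// (linear_opB linL)//; try exact: dx.
    by rewrite (linear_opB linS)//; apply: dx.
  have [] := selfadjoint_re_closed saS dx.
  - apply: (cauchy_sqn_le (M := M / mu ^+ 2)) cx => m n.
    rewrite mulrAC ler_pdivlMr// mulrC; apply: le_trans (lowB m n).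
    by rewrite lerDr sqn_ge0.
  - apply: (cauchy_sqn_le (M := M)) cx => m n; apply: le_trans (lowB m n).
    by rewrite lerDl mulr_ge0 ?sqn_ge0 ?ltW.
  move=> x0 [dx0 hx0 hSx0]; exists x0 => //.
  apply: (cvg_sqn_le2 (M := 4 * (1 + mu ^+ 2))) hx0 hSx0 => n.
  have dn : dom S (x n - x0) by apply: (linear_domB linS).
  rewrite -(linear_opB linL)//.
  rewrite LE; apply: le_trans (young dot _ _ ltr01) _.
  have Tle : sqn (T (x n - x0)) <= sqn (shift_op S mu (x n - x0)).
    apply: le_trans (bnd _ dn) _.
    by rewrite ler_piMl ?sqn_ge0// ltW.
  rewrite invr1; move: Tle; rewrite sqn_shift_op// (linear_opB linS)//.
  have := mulr_ge0 (ltW mu2) (sqn_ge0 dot (S (x n) - S x0)).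
  have := sqn_ge0 dot (x n - x0); nra.
(* As [y = (S + i mu) x] is orthogonal to [y + T x], Pythagoras bounds [y] by
   [T x], against [bnd]. *)
have [x dx xy] := shift_op_onto linS saS mu0 y.
have := orthy x dx; rewrite LE xy => yT.
have : sqn (T x) = sqn (y + T x) + sqn y.
  rewrite -{1}[T x](addKr y) [- y + _]addrC [LHS]sqnD sqnN reNr yT; lra.
have := bnd x dx; rewrite xy => h1 h2; apply: (@sqn_eq0 _ _ dot).
have := sqn_ge0 dot (y + T x); have := sqn_ge0 dot y; nra.
Qed.

(** If [z] is the adjoint value at [y], solve [(S + i mu) x0 = z + i mu y] in the
    domain of [S]; then [y - x0] is orthogonal to the range of [S - i mu], which
    is the whole space, so that [y = x0]. *)
Lemma selfadjoint_re_of_onto S mu :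
  linear_op S -> symmetric_on (dom S) S -> total_set (dom S) ->
  (forall y, exists2 x, dom S x & shift_op S mu x = y) ->
  (forall y, exists2 x, dom S x & shift_op S (- mu) x = y) ->
  selfadjoint_re S.
Proof.
move=> linS symS totS onto ontoN; split=> // y z yz.
have [x0 dx0 hx0] := onto (z + mu%:C *: ('i *: y)).
suff -> : y = x0 by [].
apply/eqP; rewrite -subr_eq0; apply/eqP.
have [x dx hx] := ontoN (y - x0).
apply: (@sqn_eq0 _ _ dot); rewrite /sqnorm -{1}hx.
have h1 : re (shift_op S (- mu) x) y = re x (z + mu%:C *: ('i *: y)).
  by rewrite /= !reE yz// reIC; lra.
have h2 : re (shift_op S (- mu) x) x0 = re x (shift_op S mu x0).
  by rewrite /= !reE symS// reIC; lra.
by rewrite reDr reNr h1 h2 hx0 subrr.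
Qed.

(** The relative bound is stated for squared norms, which costs nothing as
    long as the constant may be increased slightly (see [rel_bound_sqn]). *)
Lemma kato_rellich S T (a b : R) : linear_op S -> linear_op T ->
  selfadjoint_re S -> dom S `<=` dom T -> symmetric_on (dom S) T ->
  0 <= a < 1 ->
  (forall x, dom S x -> sqn (T x) <= a * sqn (S x) + b * sqn x) ->
  selfadjoint_re (add_op S T).
Proof.
move=> linS linT saS ST symT /andP[a0 a1] bndT; have [totS symS adjS] := saS.
(* Replacing [a] by [a'] provides a nonzero constant to divide [b] by. *)
pose a' := (1 + a) / 2.
have a'01 : 0 < a' < 1 by apply/andP; split; rewrite /a'; lra.
have a'0 : 0 < a' by case/andP: a'01.
have aa' : a <= a' by rewrite /a'; lra.
pose mu := 1 + `|b| / a'.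
have mu1 : 1 <= mu by rewrite lerDl divr_ge0// ltW.
have bmu : b <= a' * mu ^+ 2.
  apply: le_trans (ler_norm b) _.
  have -> : `|b| = a' * (mu - 1) by rewrite /mu; field; rewrite gt_eqF.
  rewrite ler_wpM2l ?(ltW a'0)//; nra.
have mu0 : mu != 0 by rewrite gt_eqF//; lra.
have bnd x : dom S x -> sqn (T x) <= a' * sqn (S x) + b * sqn x.
  move=> /bndT/le_trans; apply; rewrite lerD2r ler_wpM2r ?sqn_ge0//.
apply: (@selfadjoint_re_of_onto _ mu) => //.
- exact: linear_add_op.
- by move=> x y dx dy; rewrite /= !reE symS// symT.
- exact: (@shift_add_onto S T mu a' b).
- by apply: (@shift_add_onto S T (- mu) a' b); rewrite ?oppr_eq0 ?sqrrN.
Qed.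

End KatoRellich.

(** * Comparison with the complex adjoint and with the norm *)

Section RealAdjoint.
Context {R : realType} {V : lmodType R[i]} (dot : {dot V for (@Num.conj R[i])}).
Local Notation re := (re_dot dot).
Implicit Types (S T : operator V) (x y z : V).

(** Replacing [x] by [i x], which stays in the domain, recovers the imaginary
    parts. *)
Lemma adjoint_reP T y z : linear_op T ->
  (forall x, dom T x -> dot (T x) y = dot x z) <->
  (forall x, dom T x -> re (T x) y = re x z).
Proof.
move=> linT; split=> [h x dx|h x dx]; first by rewrite /re_dot h.
have := h _ (linear_domZ linT 'i dx); rewrite (linear_opZ linT)// !reIl.
have := h x dx; rewrite /re_dot => hR /oppr_inj hI.
by apply/eqP; rewrite eq_complex hR hI !eqxx.
Qed.

Lemma adjoint_ext S T : op_eq S T -> adjoint dot S = adjoint dot T.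
Proof.
move=> [dST ST].
pose adj U y := [set z | forall x, dom U x -> dot (U x) y = dot x z].
have E : adj S = adj T.
  apply/funext => y; rewrite /adj dST; apply/seteqP.
  by split=> z h x dx; [rewrite -ST//|rewrite ST//]; apply: h.
have adjE U : adjoint dot U =
  Operator [set y | adj U y !=set0] (fun y => xget 0 (adj U y)) by [].
by rewrite !adjE E.
Qed.

Lemma op_eq_adjoint S T : linear_op T -> selfadjoint_re dot T ->
  op_eq S T -> op_eq S (adjoint dot S).
Proof.
move=> linT saT eqST; rewrite (adjoint_ext eqST).
have [totT symT adjT] := saT; have [domST valST] := eqST.
have domT : dom T = dom (adjoint dot T).
  apply/seteqP; split=> [y dy|y [z /(adjoint_reP y z linT)]]; last exact: adjT.
  by exists (T y); apply/(adjoint_reP _ _ linT) => x dx; apply: symT.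
split=> [|y dy]; first by rewrite domST.
rewrite valST ?domT//; have [z0 yz0] := dy.
by have /(adjoint_reP _ _ linT)/(selfadjoint_re_val saT)[_ ->] := xgetI 0 yz0.
Qed.

End RealAdjoint.

Section HilbertNorm.
Context {R : realType} {X : completeNormedModType R[i]}.
Variable dot : {dot X for (@Num.conj R[i])}.
Hypothesis hilbert : forall x : X, `|x| ^+ 2 = dot x x.
Local Notation sqn := (sqnorm dot).

Definition rnorm (x : X) : R := complex.Re `|x|.

Lemma rnormE (x : X) : `|x| = (rnorm x)%:C.
Proof. by rewrite RRe_real// normr_real. Qed.

Lemma rnorm_ge0 (x : X) : 0 <= rnorm x.
Proof. by rewrite -ler0c -rnormE. Qed.

Lemma sqn_rnorm (x : X) : sqn x = rnorm x ^+ 2.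
Proof. by rewrite /sqnorm /re_dot -hilbert rnormE -rmorphXn. Qed.

Lemma norm_lt_sqn (x : X) (e : R) : 0 < e -> (`|x| < e%:C) = (sqn x < e ^+ 2).
Proof.
move=> e0; rewrite rnormE ltcR sqn_rnorm ltr_pXn2r// nnegrE ?rnorm_ge0//.
exact: ltW.
Qed.

Lemma gt0_real_complex (e : R[i]) : 0 < e -> exists2 r : R, 0 < r & e = r%:C.
Proof.
move=> e0; have er : e \is Num.real by rewrite realE ltW.
by exists (complex.Re e); [rewrite -ltcR (RRe_real er)|rewrite RRe_real].
Qed.

Lemma complete_sqn_hilbert : complete_sqn dot.
Proof.
move=> u cu.
have cvu : cvg (u @ \oo).
  apply/cauchy_cvgP/cauchy_exP => _ /gt0_real_complex[e e0 ->].
  have [N hN] := cu (e ^+ 2) (exprn_gt0 2 e0).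
  exists (u N); exists N => // n /= Nn.
  by rewrite -ball_normE /= norm_lt_sqn//; apply: hN.
exists (lim (u @ \oo)) => e e0.
have /cvgrPdist_lt/(_ (Num.sqrt e)%:C) := cvu.
rewrite ltcR sqrtr_gt0 => /(_ e0)[N _ hN]; exists N => n /hN /=.
by rewrite norm_lt_sqn ?sqrtr_gt0// sqr_sqrtr ?ltW// -(sqnN dot) opprB.
Qed.

(** A vector orthogonal to a dense set is a limit of vectors orthogonal to it. *)
Lemma total_set_dense (D : set X) : dense D -> total_set dot D.
Proof.
move=> denseD y yD; apply: (@sqn_eq0 _ _ dot); apply: re_limit0 => e e0.
have se0 : 0 < Num.sqrt e by rewrite sqrtr_gt0.
have se0' : 0 < (Num.sqrt e)%:C :> R[i] by rewrite ltcR.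
have [] := denseD (ball y (Num.sqrt e)%:C).
- by exists y; apply: ballxx.
- exact: ball_open.
move=> x []; rewrite -ball_normE /= norm_lt_sqn// sqr_sqrtr ?ltW// => xy Dx.
exists x; split; first by rewrite -(sqnN dot) opprB.
by rewrite yD// expr0n ltW.
Qed.

Lemma self_adjoint_re (T : operator X) : linear_op T -> self_adjoint dot T ->
  selfadjoint_re dot T.
Proof.
move=> linT [denT [domT eqT]]; split; first exact: total_set_dense.
- move=> x y dx dy; have : dom (adjoint dot T) y by rewrite -domT.
  move=> /[dup] /eqT -> [z yz]; have /(_ x dx) := xgetI 0 yz.
  by rewrite /re_dot => ->.
- move=> y z /(adjoint_reP _ _ _ linT) h; rewrite domT.
  by exists z.
Qed.

(** Squaring [a t + b u] creates the cross term [2 a b t u], which is absorbed by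
    the gap between [a] and [r]. *)
Lemma rel_bound_sqn (S T : operator X) (r : R) : rel_bounded S T ->
  rel_bound S T < r ->
  exists2 k, 0 <= k & forall x, dom T x -> sqn (S x) <= r ^+ 2 * sqn (T x) + k * sqn x.
Proof.
move=> [_ bnd0] ltr.
have hinf : has_inf (rel_bounds S T) by split=> //; exists 0 => a [].
have e0 : 0 < r - rel_bound S T by rewrite subr_gt0.
have [a [a0 [b b0 hab]]] := inf_adherent e0 hinf.
rewrite -/(rel_bound S T) addrC subrK => ar.
have d0 : 0 < r ^+ 2 - a ^+ 2 by rewrite subr_gt0; nra.
exists (b ^+ 2 + (a * b) ^+ 2 / (r ^+ 2 - a ^+ 2)).
  by rewrite addr_ge0 ?sqr_ge0// divr_ge0 ?sqr_ge0 ?ltW.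
move=> x /hab; rewrite !rnormE -!rmorphM -rmorphD lecR => h.
rewrite !sqn_rnorm; set s := rnorm (S x) in h *; set t := rnorm _ in h *.
set u := rnorm x in h *.
have s0 : 0 <= s := rnorm_ge0 _.
apply: (@le_trans _ _ ((a * t + b * u) ^+ 2)).
  by rewrite ler_pXn2r// nnegrE// (le_trans s0).
rewrite -subr_ge0.
have -> : r ^+ 2 * t ^+ 2 + (b ^+ 2 + (a * b) ^+ 2 / (r ^+ 2 - a ^+ 2)) * u ^+ 2 -
  (a * t + b * u) ^+ 2 =
  ((r ^+ 2 - a ^+ 2) * t - a * b * u) ^+ 2 / (r ^+ 2 - a ^+ 2).
  by field; rewrite gt_eqF.
by rewrite divr_ge0 ?sqr_ge0 ?ltW.
Qed.

End HilbertNorm.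

(** * The block operator matrix *)

Section BlockOperator.
Context {R : realType} {V : lmodType R[i]} (dot : {dot V for (@Num.conj R[i])}).
Hypothesis complete_dot : complete_sqn dot.
Local Notation re := (re_dot dot).
Local Notation sqn := (sqnorm dot).
Local Notation pdot := (prod_dot dot).
Implicit Types (A B C : operator V) (l : R).

Definition offdiag_op A : operator (V * V) :=
  Operator (dom A `*` dom A) (fun p => (- A p.2, - A p.1)).

Definition diag_op B C l : operator (V * V) :=
  Operator (dom C `*` dom B) (fun p => (l%:C *: C p.1, - (l^-1%:C *: B p.2))).

(** The product [J H] for a self-adjoint [A]. *)
Definition jhamiltonian_op A B C : operator (V * V) :=
  Operator (dom A `*` dom A) (fun p => (C p.1 - A p.2, - A p.1 - B p.2)).

Lemma linear_offdiag_op A : linear_op A -> linear_op (offdiag_op A).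
Proof.
move=> linA; have A0 : dom A 0 by case: linA.
split=> [//|a p q [p1 p2] [q1 q2]|a p q [p1 p2] [q1 q2]].
  by split; apply: (linear_domP linA).
rewrite /= !(linear_opP linA)//.
by congr pair; rewrite opprD -scalerN.
Qed.

Lemma linear_diag_op B C l : linear_op B -> linear_op C ->
  linear_op (diag_op B C l).
Proof.
move=> linB linC.
split=> [|a p q [p1 p2] [q1 q2]|a p q [p1 p2] [q1 q2]].
- by split; [case: linC|case: linB].
- by split; [apply: (linear_domP linC)|apply: (linear_domP linB)].
rewrite /= (linear_opP linC)// (linear_opP linB)//.
congr pair => /=; rewrite scalerDr ?opprD ?scalerN !scalerA.
  by rewrite [_ * a]mulrC.
by rewrite [_ * a]mulrC.
Qed.

Lemma linear_jhamiltonian_op A B C : linear_op A -> linear_op B -> linear_op C ->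
  dom A `<=` dom B -> dom A `<=` dom C -> linear_op (jhamiltonian_op A B C).
Proof.
move=> linA linB linC AB AC; have A0 : dom A 0 by case: linA.
split=> [//|a p q [p1 p2] [q1 q2]|a p q [p1 p2] [q1 q2]].
  by split; apply: (linear_domP linA).
rewrite /= !(linear_opP linA)// (linear_opP linC) ?(linear_opP linB)//;
  try by [apply: AB|apply: AC].
by congr pair => /=; rewrite !opprD addrACA scalerBr ?scalerN.
Qed.

Lemma total_set_prod (D : set V) : D 0 -> total_set dot D ->
  total_set pdot (D `*` D).
Proof.
move=> D0 totD [y1 y2] orth; congr pair; apply: totD => x dx.
  by have := orth (x, 0) (conj dx D0); rewrite re_prod /= re0l addr0.
by have := orth (0, x) (conj D0 dx); rewrite re_prod /= re0l add0r.
Qed.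

Lemma selfadjoint_offdiag_op A : linear_op A -> selfadjoint_re dot A ->
  selfadjoint_re pdot (offdiag_op A).
Proof.
move=> linA [totA symA adjA]; have A0 : dom A 0 by case: linA.
split; first exact: total_set_prod.
  move=> p q [p1 p2] [q1 q2]; rewrite !re_prod /= !reNl !reNr !symA//; lra.
move=> [y1 y2] [z1 z2] yz; split=> /=.
  apply: (adjA _ (- z2)) => x dx.
  have := yz (0, x) (conj A0 dx).
  by rewrite !re_prod /= (linear_op0 linA) oppr0 !re0l !reNl reNr; lra.
apply: (adjA _ (- z1)) => x dx.
have := yz (x, 0) (conj dx A0).
by rewrite !re_prod /= (linear_op0 linA) oppr0 !re0l !reNl reNr; lra.
Qed.

(** The congruence by [diag (l, 1)] turns [jhamiltonian_op A B C] into [l] times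
    [add_op (offdiag_op A) (diag_op B C l)].  Only the product of the bounds
    [r1] and [r2] matters, because [l] balances them. *)
Lemma selfadjoint_jhamiltonian_op A B C (r1 r2 k1 k2 : R) :
  linear_op A -> linear_op B -> linear_op C -> selfadjoint_re dot A ->
  dom A `<=` dom B -> dom A `<=` dom C ->
  symmetric_on dot (dom A) B -> symmetric_on dot (dom A) C ->
  0 < r1 -> 0 < r2 -> r1 * r2 < 1 -> 0 <= k1 -> 0 <= k2 ->
  (forall x, dom A x -> sqn (C x) <= r1 ^+ 2 * sqn (A x) + k1 * sqn x) ->
  (forall x, dom A x -> sqn (B x) <= r2 ^+ 2 * sqn (A x) + k2 * sqn x) ->
  selfadjoint_re pdot (jhamiltonian_op A B C).
Proof.
move=> linA linB linC saA AB AC symB symC r10 r20 r12 k10 k20 bndC bndB.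
have [totA symA adjA] := saA; have A0 : dom A 0 by case: linA.
pose l := Num.sqrt (r2 / r1).
have l0 : 0 < l by rewrite sqrtr_gt0 divr_gt0.
have l2 : l ^+ 2 = r2 / r1 by rewrite sqr_sqrtr// divr_ge0// ltW.
have lV : l * l^-1 = 1 by rewrite mulfV// gt_eqF.
have [_ _ adjK] : selfadjoint_re pdot (add_op (offdiag_op A) (diag_op B C l)).
  apply: (@kato_rellich _ _ _ _ _ _ (r1 * r2) (k1 * (r2 / r1) + k2 * (r1 / r2))).
  - exact: complete_prod.
  - exact: linear_offdiag_op.
  - exact: linear_diag_op.
  - exact: selfadjoint_offdiag_op.
  - by move=> p [/AC p1 /AB p2].
  - move=> p q [p1 p2] [q1 q2].
    by rewrite !re_prod /= !reE symB// symC//.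
  - by rewrite r12 andbT mulr_ge0// ltW.
  move=> [x1 x2] [/= d1 d2].
  rewrite !sqn_prod /= !sqnN !sqnZ exprVn l2 invf_div.
  have c1 := ler_wpM2l (ltW (divr_gt0 r20 r10)) (bndC _ d1).
  have c2 := ler_wpM2l (ltW (divr_gt0 r10 r20)) (bndB _ d2).
  apply: le_trans (lerD c1 c2) _.
  have h1 : 0 <= k1 * (r2 / r1) * sqn x2.
    by rewrite mulr_ge0 ?sqn_ge0// mulr_ge0// divr_ge0// ltW.
  have h2 : 0 <= k2 * (r1 / r2) * sqn x1.
    by rewrite mulr_ge0 ?sqn_ge0// mulr_ge0// divr_ge0// ltW.
  rewrite -subr_ge0 (_ : _ - _ = k1 * (r2 / r1) * sqn x2 + k2 * (r1 / r2) * sqn x1).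
    exact: addr_ge0.
  by field; rewrite !gt_eqF.
split; first exact: total_set_prod.
  move=> p q [p1 p2] [q1 q2]; rewrite !re_prod /= !reE !symA// symB// symC//; lra.
move=> [y1 y2] [z1 z2] yz.
(* The adjoint relation for [y] against [(x1, l^-1 x2)] is the one of the
   rescaled operator for [(l^-1 y1, y2)] against [(x1, x2)]. *)
suff [dy1 dy2] : dom (offdiag_op A) (l^-1%:C *: y1, y2).
  split=> //=; have := linear_domZ linA l%:C dy1.
  by rewrite /= scalerA -rmorphM lV scale1r.
apply: (adjK _ (z1, l^-1%:C *: z2)) => [[x1 x2]] [/= d1 d2].
have := yz (x1, 0) (conj d1 A0).
rewrite !re_prod /= (linear_op0 linA) (linear_op0 linB) subr0 subr0 re0l addr0.
have := yz (0, l^-1%:C *: x2) (conj A0 (linear_domZ linA _ d2)).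
rewrite !re_prod /= (linear_op0 linA) (linear_op0 linC) (linear_opZ linA)//.
rewrite (linear_opZ linB) ?oppr0 ?sub0r ?add0r; last exact: AB.
rewrite !reE re0l.
rewrite [l * _]mulrA lV mul1r; lra.
Qed.

End BlockOperator.

Lemma rel_bound_ge0 (R : realType) (X : normedModType R[i]) (S T : operator X) :
  rel_bounded S T -> 0 <= rel_bound S T.
Proof. by move=> [_ bnd0]; apply: lb_le_inf => // a []. Qed.

Theorem corollary3p3 (R : realType) (X : completeNormedModType R[i])
    (dot : {dot X for (@Num.conj R[i])})
    (hilbert : forall x : X, `|x| ^+ 2 = dot x x)
    (A B C : operator X)
    (hamH : is_hamiltonian dot A B C)
    (domH : dom (hamiltonian_op dot A B C) = dom A `*` dom (adjoint dot A))
    (saA : self_adjoint dot A)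
    (hbound :
      (rel_bounded C A /\ rel_bound C A < 1 /\
       rel_bounded B (adjoint dot A) /\ rel_bound B (adjoint dot A) <= 1)
      \/
      (rel_bounded C A /\ rel_bound C A <= 1 /\
       rel_bounded B (adjoint dot A) /\ rel_bound B (adjoint dot A) < 1)) :
  op_eq (comp_op (J_op X) (hamiltonian_op dot A B C))
    (adjoint (prod_dot dot) (comp_op (J_op X) (hamiltonian_op dot A B C))).
Proof.
have [[linA linB linC] _ _ [saB saC] _] := hamH.
have reA := self_adjoint_re hilbert linA saA.
have [_ symB _] := self_adjoint_re hilbert linB saB.
have [_ symC _] := self_adjoint_re hilbert linC saC.
have [_ [domA eqA]] := saA.
have [bC [bB [r1 [r2 [r10 r20 r12 r1C r2B]]]]] :
    rel_bounded C A /\ rel_bounded B (adjoint dot A) /\ exists r1 r2 : R,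
    [/\ 0 < r1, 0 < r2, r1 * r2 < 1, rel_bound C A < r1 &
        rel_bound B (adjoint dot A) < r2].
  (* The bound that is below one leaves room for the other factor to exceed one. *)
  have between (c : R) : 0 <= c -> c < 1 ->
      exists r s : R, [/\ 0 < r, 1 < s, r * s < 1 & c < r].
    move=> c0 c1; pose r := (1 + c) / 2.
    have r0 : 0 < r by rewrite /r; lra.
    have r1 : r < 1 by rewrite /r; lra.
    exists r, ((1 + r^-1) / 2).
    have rV : r * r^-1 = 1 by rewrite mulfV// gt_eqF.
    have rV1 : 1 < r^-1 by rewrite invf_gt1.
    by split=> //; [lra | rewrite mulrA mulrDr rV; lra | rewrite /r; lra].
  case: hbound => -[bC [ltC [bB ltB]]]; split=> //; split=> //.
    have [r [s [r0 s1 rs cr]]] := between _ (rel_bound_ge0 bC) ltC.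
    exists r, s; split=> //; [exact: lt_trans ltr01 s1|exact: le_lt_trans ltB s1].
  have [r [s [r0 s1 rs cr]]] := between _ (rel_bound_ge0 bB) ltB.
  exists s, r; split=> //; first exact: lt_trans ltr01 s1.
    by rewrite mulrC.
  exact: le_lt_trans ltC s1.
have [k1 k10 bndC] := rel_bound_sqn hilbert bC r1C.
have [k2 k20 bndB] := rel_bound_sqn hilbert bB r2B.
have AC : dom A `<=` dom C by case: bC.
have AB : dom A `<=` dom B by rewrite domA; case: bB.
have saK : selfadjoint_re (prod_dot dot) (jhamiltonian_op A B C).
  apply: (@selfadjoint_jhamiltonian_op _ _ _ _ _ _ _ r1 r2 k1 k2) => //.
  - exact: complete_sqn_hilbert.
  - by move=> x y dx dy; apply: symB; apply: AB.
  - by move=> x y dx dy; apply: symC; apply: AC.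
  - by move=> x; rewrite domA => dx; rewrite eqA//; apply: bndB.
have linK := linear_jhamiltonian_op linA linB linC AB AC.
have domHA : dom (hamiltonian_op dot A B C) = dom A `*` dom A.
  by rewrite domH -domA.
have JHK : op_eq (comp_op (J_op X) (hamiltonian_op dot A B C)) (jhamiltonian_op A B C).
  split=> [|p [d1 d2]]; last first.
    change ((0 + (C p.1 - adjoint dot A p.2), - (A p.1 + B p.2) + 0) =
            (C p.1 - A p.2, - A p.1 - B p.2)).
    by rewrite add0r addr0 opprD -eqA// -domA.
  apply/seteqP; split=> p; first by case; rewrite domHA.
  by move=> dp; split; [rewrite domHA | split; split].
exact: (op_eq_adjoint linK saK JHK).
Qed.
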